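(* Let $\boldsymbol{\theta}^\ast=(\lambda^\ast,\{u_i^\ast\}_{i=1}^n,\{v_j^\ast\}_{j=1}^p,(\sigma^\ast)^2)$ be the converged rSVDdpd estimator for the matrix $\boldsymbol{X}$, starting from an initial estimate $\boldsymbol{\theta}^{(0)}=(\lambda^{(0)},\{u_i^{(0)}\}_{i=1}^n,\{v_j^{(0)}\}_{j=1}^p,(\sigma^{(0)})^2)$. Then, for any constant $c\in\mathbb{R}\setminus\{0\}$, the rSVDdpd estimator for the data matrix $\boldsymbol{X}'=c\boldsymbol{X}$ converges to $(c\lambda^\ast,\{u_i^\ast\}_{i=1}^n,\{v_j^\ast\}_{j=1}^p,(c\sigma^\ast)^2)$ provided the initial estimate is $(c\lambda^{(0)},\{u_i^{(0)}\}_{i=1}^n,\{v_j^{(0)}\}_{j=1}^p,(c\sigma^{(0)})^2)$.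
   Context: $\boldsymbol{X}=(X_{ij})$ is a real $n\times p$ data matrix. The errors of a rank-one fit $X_{ij}\approx\lambda u_iv_j$ are modelled by the scale family $\{\sigma^{-1}f(\cdot/\sigma):\sigma>0\}$, where $f$ is a known probability density on $\mathbb{R}$ with $f(x)=f(-x)$ whose derivative $f'$ exists. The robustness parameter is $\alpha\ge 0$ ($\alpha=0$ with $f$ standard normal gives the classical SVD iteration). Put $M_f=\int f^{1+\alpha}$, let $s(x)=f'(x)/f(x)$ be the score function of $f$, and let $\psi(x)=-f^\alpha(|x|)\,s(|x|)/|x|$. The parameter is $\boldsymbol{\theta}=(\lambda,\{u_i\}_{i=1}^n,\{v_j\}_{j=1}^p,\sigma^2)$, consisting of the first singular value, the entries of the corresponding left and right singular vectors, and the scale parameter. The parameter space is $\boldsymbol{\Theta}=(0,\infty)\times S_n^+\times S_p\times[\epsilon,\infty)$, where $\epsilon>0$ is a small positive quantity, $S_n^+=\{(x_1,\dots,x_n):\sum_{i=1}^n x_i^2=1,\ x_i\ge 0\text{ for all }i\}$, and $S_p$ is the unit sphere of $\mathbb{R}^p$. The rSVDdpd iteration for $\boldsymbol{X}$ started from an initial estimate $\boldsymbol{\theta}^{(0)}$ produces $\boldsymbol{\theta}^{(t)}=(\lambda^{(t)},\{u_i^{(t)}\},\{v_j^{(t)}\},(\sigma^2)^{(t)})$, with the singular vectors normalized to unit Euclidean length. With $e_{ij}^{(t)}=X_{ij}-\lambda^{(t)}u_i^{(t)}v_j^{(t)}$ and $\sigma^{(t)}=\sqrt{(\sigma^2)^{(t)}}$,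 the iterates are related, for $t=0,1,\dots$, by $$\lambda^{(t+1)}u_i^{(t+1)}=\frac{\sum_j v_j^{(t)}X_{ij}\,\psi(e_{ij}^{(t)}/\sigma^{(t)})}{\sum_j (v_j^{(t)})^2\,\psi(e_{ij}^{(t)}/\sigma^{(t)})},\qquad \lambda^{(t+1)}v_j^{(t+1)}=\frac{\sum_i u_i^{(t+1)}X_{ij}\,\psi(e_{ij}^{(t)}/\sigma^{(t)})}{\sum_i (u_i^{(t+1)})^2\,\psi(e_{ij}^{(t)}/\sigma^{(t)})},$$ $$(\sigma^2)^{(t+1)}=\frac{(np)^{-1}\sum_{i,j}(e_{ij}^{(t)})^2\,\psi(e_{ij}^{(t)}/\sigma^{(t)})}{(np)^{-1}\sum_{i,j}\psi(e_{ij}^{(t)}/\sigma^{(t)})-\frac{\alpha}{1+\alpha}M_f}.$$ The converged rSVDdpd estimator $\boldsymbol{\theta}^\ast$ is the limit of the sequence $\boldsymbol{\theta}^{(t)}$. The rSVDdpd estimator for $c\boldsymbol{X}$ is obtained from the same iteration with $X_{ij}$ replaced by $cX_{ij}$. *)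

(* Defs.v *)
From HB Require Import structures.
From mathcomp Require Import all_boot all_order all_algebra.
From mathcomp Require Import all_classical all_reals all_analysis.
From mathcomp Require Import ring lra.

Set Implicit Arguments.
Unset Strict Implicit.
Unset Printing Implicit Defensive.

Import Order.TTheory GRing.Theory Num.Theory.
Import numFieldNormedType.Exports.

Local Open Scope classical_set_scope.
Local Open Scope ring_scope.

(* (lambda, u, v, sigma^2), with the product topology *)
Definition param (R : realType) (n p : nat) : Type :=
  (R * 'rV[R]_n * 'rV[R]_p * R)%type.

HB.instance Definition _ (R : realType) (n p : nat) :=
  Topological.copy (param R n p) (R * 'rV[R]_n * 'rV[R]_p * R)%type.

Section Model.
Variable R : realType.

Definition Mf (f : R -> R) (alpha : R) : R :=
  \int[@lebesgue_measure R]_x (f x `^ (1 + alpha)).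

Definition score (f : R -> R) (x : R) : R := derive1 f x / f x.

(* [- f^alpha(|x|) s(|x|) / |x|] is undefined at [x = 0]; [psi0] is the value
   used there, e.g. the limit at 0 when it exists. *)
Definition psi (f : R -> R) (alpha psi0 x : R) : R :=
  if x == 0 then psi0 else - (f `|x| `^ alpha * score f `|x| / `|x|).

Section Param.
Variables n p : nat.
Implicit Types (f : R -> R) (alpha : R).
Implicit Types (X : 'M[R]_(n, p)) (theta : param R n p).

Definition lam theta : R := theta.1.1.1.
Definition lvec theta : 'rV[R]_n := theta.1.1.2.
Definition rvec theta : 'rV[R]_p := theta.1.2.
Definition sigma2 theta : R := theta.2.

Definition unit_sphere (m : nat) : set 'rV[R]_m :=
  [set x | \sum_i (x 0 i) ^+ 2 = 1].

Definition nonneg_sphere (m : nat) : set 'rV[R]_m :=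
  [set x | unit_sphere x /\ forall i, 0 <= x 0 i].

Definition param_space (eps : R) : set (param R n p) :=
  [set theta | [/\ 0 < lam theta, nonneg_sphere (lvec theta),
                   unit_sphere (rvec theta) & eps <= sigma2 theta]].

Definition scale_param (c : R) theta : param R n p :=
  (c * lam theta, lvec theta, rvec theta, c ^+ 2 * sigma2 theta).

Definition residual X theta (i : 'I_n) (j : 'I_p) : R :=
  X i j - lam theta * lvec theta 0 i * rvec theta 0 j.

Definition weight f alpha psi0 X theta (i : 'I_n) (j : 'I_p) : R :=
  psi f alpha psi0 (residual X theta i j / Num.sqrt (sigma2 theta)).

Definition left_den f alpha psi0 X theta (i : 'I_n) : R :=
  \sum_j (rvec theta 0 j) ^+ 2 * weight f alpha psi0 X theta i j.

Definition left_update f alpha psi0 X theta (i : 'I_n) : R :=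
  (\sum_j rvec theta 0 j * X i j * weight f alpha psi0 X theta i j)
  / left_den f alpha psi0 X theta i.

Definition right_den f alpha psi0 X theta (u : 'rV[R]_n) (j : 'I_p) : R :=
  \sum_i (u 0 i) ^+ 2 * weight f alpha psi0 X theta i j.

Definition right_update f alpha psi0 X theta (u : 'rV[R]_n) (j : 'I_p) : R :=
  (\sum_i u 0 i * X i j * weight f alpha psi0 X theta i j)
  / right_den f alpha psi0 X theta u j.

Definition scale_den f alpha psi0 X theta : R :=
  (n * p)%:R^-1 * (\sum_i \sum_j weight f alpha psi0 X theta i j)
  - alpha / (1 + alpha) * Mf f alpha.

Definition scale_update f alpha psi0 X theta : R :=
  ((n * p)%:R^-1 *
     \sum_i \sum_j (residual X theta i j) ^+ 2 * weight f alpha psi0 X theta i j)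
  / scale_den f alpha psi0 X theta.

(* One iteration, from [theta] to [theta'].  Each of the two alternating
   regressions returns a multiple of a unit vector: the multiple [mu] found with
   the left vector is provisional, and the one found with the right vector is
   the new singular value.  The regressions fix these multiples only up to sign,
   and both inherit the sign of the current singular value; thus a run started
   in [param_space] keeps positive singular values, and a run started from a
   negative value (as for [c * X] with [c < 0]) keeps negative ones.  A step
   also requires all quotients in it to be defined. *)
Record rsvddpd_step f alpha psi0 X theta theta' : Prop := {
  step_sigma2_gt0 : 0 < sigma2 theta;
  step_left_den : forall i, left_den f alpha psi0 X theta i != 0;
  step_right_den :
    forall j, right_den f alpha psi0 X theta (lvec theta') j != 0;
  step_scale_den : scale_den f alpha psi0 X theta != 0;
  step_left_unit : unit_sphere (lvec theta');
  step_right_unit : unit_sphere (rvec theta');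
  step_left : exists2 mu : R, 0 < lam theta * mu &
    forall i, mu * lvec theta' 0 i = left_update f alpha psi0 X theta i;
  step_sign : 0 < lam theta * lam theta';
  step_right : forall j,
    lam theta' * rvec theta' 0 j
    = right_update f alpha psi0 X theta (lvec theta') j;
  step_scale : sigma2 theta' = scale_update f alpha psi0 X theta }.

Definition rsvddpd_estimator f alpha psi0 X
    (theta0 thetastar : param R n p) : Prop :=
  exists theta : nat -> param R n p,
    [/\ theta 0%N = theta0,
        forall t, rsvddpd_step f alpha psi0 X (theta t) (theta t.+1)
      & theta t @[t --> \oo] --> thetastar].

Lemma unit_multiple_unique (m : nat) (l a b : R) (x y : 'rV[R]_m) :
  unit_sphere x -> unit_sphere y -> 0 < l * a -> 0 < l * b ->
  (forall i, a * x 0 i = b * y 0 i) -> a = b /\ x = y.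
Proof.
move=> hx hy la lb hxy.
have ab2 : a ^+ 2 = b ^+ 2.
  rewrite -[a ^+ 2]mulr1 -hx -[b ^+ 2]mulr1 -hy !mulr_sumr.
  by apply: eq_bigr => i _; rewrite -!exprMn hxy.
have ab : a = b.
  move/eqP: ab2; rewrite eqf_sqr => /orP[/eqP//|/eqP ab].
  by exfalso; move: la lb; rewrite ab mulrN; lra.
split=> //; apply/rowP => i; have := hxy i; rewrite ab; apply: mulfI.
by apply: contraTneq lb => ->; rewrite mulr0 ltxx.
Qed.

(* The next iterate, hence the whole run, is determined by the current one. *)
Lemma rsvddpd_step_unique f alpha psi0 X theta theta1 theta2 :
  rsvddpd_step f alpha psi0 X theta theta1 ->
  rsvddpd_step f alpha psi0 X theta theta2 -> theta1 = theta2.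
Proof.
case: theta1 theta2 => [[[l1 u1] v1] s1] [[[l2 u2] v2] s2].
case=> _ _ _ _ u1u v1u [m1 m1p hu1] l1p hv1 hs1.
case=> _ _ _ _ u2u v2u [m2 m2p hu2] l2p hv2 hs2.
rewrite /lam /lvec /rvec /sigma2 /= in u1u v1u hu1 l1p hv1 hs1
  u2u v2u hu2 l2p hv2 hs2.
have hu i : m1 * u1 0 i = m2 * u2 0 i by rewrite hu1 hu2.
have [_ eu] := unit_multiple_unique u1u u2u m1p m2p hu; subst u2.
have hv j : l1 * v1 0 j = l2 * v2 0 j by rewrite hv1 hv2.
have [-> ->] := unit_multiple_unique v1u v2u l1p l2p hv.
by rewrite hs1 hs2.
Qed.

End Param.
End Model.

(* Main.v *)
Require Import Defs.
From mathcomp Require Import all_boot all_order all_algebra.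
From mathcomp Require Import all_classical all_reals all_analysis.

Set Implicit Arguments.
Unset Strict Implicit.
Unset Printing Implicit Defensive.

Import Order.TTheory GRing.Theory Num.Theory.
Import numFieldNormedType.Exports.

Local Open Scope classical_set_scope.
Local Open Scope ring_scope.

(** The iteration is equivariant under [X -> c X]: the dilation
    [scale_param c] of the parameter commutes with one step.  The residuals are
    multiplied by [c] and the scale [sigma] by [|c|], so the standardized
    residuals change at most by a sign, which the even function [psi] does not
    see: all weights are unchanged ([weight_scale]).  With the weights fixed,
    the two regressions are linear in the data and the scale update is
    quadratic in the residuals, so their values are multiplied by [c] and
    [c ^+ 2], while their denominators do not change.  Hence the dilation
    of a run for [X] is a run for [c *: X] ([rsvddpd_step_scale]), and its limit
    is the dilation of the limit because [scale_param c] is continuous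
    ([scale_param_continuous]). *)

Section ScaleEquivariance.
Variables (R : realType) (n p : nat).
Variables (f : R -> R) (alpha psi0 c : R).
Implicit Types (X : 'M[R]_(n, p)) (theta : param R n p).

Lemma psi_norm_eq (x y : R) :
  `|x| = `|y| -> psi f alpha psi0 x = psi f alpha psi0 y.
Proof. by move=> xy; rewrite /psi -normr_eq0 xy normr_eq0. Qed.

Lemma residual_scale X theta i j :
  residual (c *: X) (scale_param c theta) i j = c * residual X theta i j.
Proof.
by rewrite /residual /lam /lvec /rvec /= !mxE mulrBr !mulrA.
Qed.

Hypothesis c_neq0 : c != 0.

(** Only the absolute value of the standardized residual matters, so a
    negative [c] is allowed even though [sigma] is multiplied by [|c|]. *)
Lemma weight_scale X theta i j :
  weight f alpha psi0 (c *: X) (scale_param c theta) i j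
  = weight f alpha psi0 X theta i j.
Proof.
apply: psi_norm_eq; rewrite residual_scale /sigma2 /= sqrtrM ?sqr_ge0//.
rewrite sqrtr_sqr -mulf_div normrM normf_div normr_id divff ?mul1r//.
by rewrite normr_eq0.
Qed.

Lemma left_den_scale X theta i :
  left_den f alpha psi0 (c *: X) (scale_param c theta) i
  = left_den f alpha psi0 X theta i.
Proof. by apply: eq_bigr => j _; rewrite weight_scale. Qed.

Lemma right_den_scale X theta u j :
  right_den f alpha psi0 (c *: X) (scale_param c theta) u j
  = right_den f alpha psi0 X theta u j.
Proof. by apply: eq_bigr => i _; rewrite weight_scale. Qed.

Lemma scale_den_scale X theta :
  scale_den f alpha psi0 (c *: X) (scale_param c theta)
  = scale_den f alpha psi0 X theta.
Proof.
rewrite /scale_den; congr (_ * _ - _).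
by apply: eq_bigr => i _; apply: eq_bigr => j _; rewrite weight_scale.
Qed.

Lemma left_update_scale X theta i :
  left_update f alpha psi0 (c *: X) (scale_param c theta) i
  = c * left_update f alpha psi0 X theta i.
Proof.
rewrite /left_update left_den_scale mulrA mulr_sumr; congr (_ / _).
by apply: eq_bigr => j _; rewrite weight_scale mxE mulrCA !mulrA.
Qed.

Lemma right_update_scale X theta u j :
  right_update f alpha psi0 (c *: X) (scale_param c theta) u j
  = c * right_update f alpha psi0 X theta u j.
Proof.
rewrite /right_update right_den_scale mulrA mulr_sumr; congr (_ / _).
by apply: eq_bigr => i _; rewrite weight_scale mxE mulrCA !mulrA.
Qed.

Lemma scale_update_scale X theta :
  scale_update f alpha psi0 (c *: X) (scale_param c theta)
  = c ^+ 2 * scale_update f alpha psi0 X theta.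
Proof.
rewrite /scale_update scale_den_scale mulrA; congr (_ / _).
rewrite [RHS]mulrCA; congr (_ * _); rewrite mulr_sumr; apply: eq_bigr => i _.
rewrite mulr_sumr; apply: eq_bigr => j _.
by rewrite weight_scale residual_scale exprMn -mulrA.
Qed.

(** The sign conditions of a step survive a negative [c] because they compare
    two multipliers that both change sign. *)
Lemma rsvddpd_step_scale X theta theta' :
  rsvddpd_step f alpha psi0 X theta theta' ->
  rsvddpd_step f alpha psi0 (c *: X) (scale_param c theta)
    (scale_param c theta').
Proof.
have c2_gt0 : 0 < c ^+ 2 by rewrite exprn_even_gt0.
have scale_sign (a b : R) : 0 < a * b -> 0 < c * a * (c * b).
  by move=> ab_gt0; rewrite mulrACA -expr2 mulr_gt0.
case=> s_gt0 lden rden sden lunit runit [mu mu_sign left_eq] sgn right_eq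
  scale_eq.
split=> //.
- exact: mulr_gt0.
- by move=> i; rewrite left_den_scale.
- by move=> j; rewrite right_den_scale.
- by rewrite scale_den_scale.
- exists (c * mu); first exact: scale_sign.
  by move=> i; rewrite left_update_scale -left_eq mulrA.
- exact: scale_sign.
- by move=> j; rewrite right_update_scale -right_eq mulrA.
- by rewrite scale_update_scale -scale_eq.
Qed.

End ScaleEquivariance.

Lemma scale_param_continuous (R : realType) (n p : nat) (c : R) :
  continuous (@scale_param R n p c).
Proof.
move=> theta.
have cvg_sigma2 : (@sigma2 R n p) x @[x --> theta] --> sigma2 theta.
  exact: cvg_snd.
have cvg_uv : x.1 @[x --> theta] --> theta.1 by exact: cvg_fst.
have cvg_rvec : (@rvec R n p) x @[x --> theta] --> rvec theta.
  by apply: cvg_comp cvg_uv _; exact: cvg_snd.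
have cvg_lu : x.1.1 @[x --> theta] --> theta.1.1.
  by apply: cvg_comp cvg_uv _; exact: cvg_fst.
have cvg_lvec : (@lvec R n p) x @[x --> theta] --> lvec theta.
  by apply: cvg_comp cvg_lu _; exact: cvg_snd.
have cvg_lam : (@lam R n p) x @[x --> theta] --> lam theta.
  by apply: cvg_comp cvg_lu _; exact: cvg_fst.
have cvg_clam : c * lam x @[x --> theta] --> c * lam theta.
  exact: cvgM (cvg_cst _) cvg_lam.
have cvg_csigma2 : c ^+ 2 * sigma2 x @[x --> theta] --> c ^+ 2 * sigma2 theta.
  exact: cvgM (cvg_cst _) cvg_sigma2.
exact: cvg_pair (cvg_pair (cvg_pair cvg_clam cvg_lvec) cvg_rvec) cvg_csigma2.
Qed.

Theorem theorem3p6 (R : realType) (n p : nat)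
  (f : R -> R)
  (f_ge0 : forall x, 0 <= f x)
  (f_int1 : (\int[@lebesgue_measure R]_x (f x)%:E = 1)%E)
  (f_even : forall x, f (- x) = f x)
  (f_deriv : forall x, derivable f x 1)
  (alpha : R) (alpha_ge0 : 0 <= alpha)
  (psi0 : R)
  (eps : R) (eps_gt0 : 0 < eps)
  (X : 'M[R]_(n, p))
  (theta0 thetastar : param R n p)
  (theta0_in : param_space eps theta0)
  (thetastar_in : param_space eps thetastar)
  (conv : rsvddpd_estimator f alpha psi0 X theta0 thetastar)
  (c : R) (c_neq0 : c != 0) :
  rsvddpd_estimator f alpha psi0 (c *: X)
    (scale_param c theta0) (scale_param c thetastar).
Proof.
have [theta [theta_init step theta_cvg]] := conv.
exists (fun t => scale_param c (theta t)); split.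
- by rewrite theta_init.
- by move=> t; exact: rsvddpd_step_scale.
- exact: cvg_comp theta_cvg (@scale_param_continuous R n p c thetastar).
Qed.
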